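(* For every real number $s>1$ and every complex number $z$ with $|z|<1$, $$\prod_{i\ge 1}\bigl(1-z^i\bigr)^{-1/i^{s}}=\prod_{i\ge 1}\hat\Phi_i(z)^{-\zeta(s)/i^{s}},$$ where $\zeta$ is the Riemann zeta function and $\hat\Phi_i(z)=\prod_{1\le k\le i,\ \gcd(k,i)=1}\bigl(1-z e^{2\pi \sqrt{-1}\,k/i}\bigr)$.
   Context: The polynomials $\hat\Phi_i$ satisfy $\hat\Phi_1(z)=1-z$ and $\hat\Phi_i=\Phi_i$ (the $i$-th cyclotomic polynomial) for $i\ge 2$. On $|z|<1$ one has $\hat\Phi_i(z)\neq 0$ and $\hat\Phi_i(0)=1$; $\operatorname{Log}\hat\Phi_i$ denotes the unique holomorphic branch of the logarithm of $\hat\Phi_i$ on $|z|<1$ with $\operatorname{Log}\hat\Phi_i(0)=0$, and $\operatorname{Log}(1-z^i)$ denotes the principal branch, which is holomorphic on $|z|<1$ and vanishes at $z=0$. Powers are interpreted as $\hat\Phi_i(z)^{a}=\exp\bigl(a\operatorname{Log}\hat\Phi_i(z)\bigr)$ and $(1-z^i)^{a}=\exp\bigl(a\operatorname{Log}(1-z^i)\bigr)$. Infinite products are limits of partial products. *)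

(* Defs.v *)
From mathcomp Require Import all_boot.
From Stdlib Require Import Reals ClassicalEpsilon.
From Coquelicot Require Import Coquelicot.

Set Implicit Arguments.
Unset Strict Implicit.
Unset Printing Implicit Defensive.

Local Open Scope R_scope.
Local Open Scope C_scope.

Definition Cexp (w : C) : C :=
  (exp (Re w) * cos (Im w), exp (Re w) * sin (Im w))%R.

(* Principal argument, with values in (-PI, PI] (irrelevant value at 0). *)
Definition Carg (w : C) : R :=
  if Rle_dec 0 (Im w) then acos (Re w / Cmod w) else (- acos (Re w / Cmod w))%R.

(* Principal branch of the complex logarithm. *)
Definition Clog (w : C) : C := (ln (Cmod w), Carg w).

(* [ex_derive] is taken over the field C: complex differentiability. *)
Definition holomorphic_on_disc (f : C -> C) : Prop :=
  forall z : C, Cmod z < 1 -> @ex_derive C_AbsRing C_NormedModule f z.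

Definition is_disc_log (f L : C -> C) : Prop :=
  holomorphic_on_disc L /\
  (forall z : C, Cmod z < 1 -> Cexp (L z) = f z) /\
  L 0 = 0.

(* The branch of log f on the open unit disc that vanishes at 0. It is
   determined on the disc by [is_disc_log] as soon as f is holomorphic and
   without zeros there and f 0 = 1; its values elsewhere are irrelevant. *)
Definition disc_log (f : C -> C) : C -> C :=
  epsilon (inhabits (fun _ : C => RtoC 0)) (is_disc_log f).

Definition cyclo_hat (i : nat) (z : C) : C :=
  \big[Cmult/RtoC 1]_(1 <= k < i.+1 | coprime k i)
    (1 - z * Cexp (2 * PI * Ci * (INR k / INR i))).

(* The Riemann zeta function on the half-line s > 1, where it is the sum of
   its Dirichlet series. *)
Definition zeta (s : R) : R :=
  Series (fun n : nat => / Rpower (INR n.+1) s)%R.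

(* The infinite product of a i over i >= 1 converges to P, as a limit of
   partial products (the value P = 0 is not excluded). *)
Definition is_inf_prod (a : nat -> C) (P : C) : Prop :=
  filterlim (fun N : nat => \big[Cmult/RtoC 1]_(1 <= i < N.+1) a i)
    eventually (locally P).

(* Main.v *)
(* Let L_d be the logarithm of cyclo_hat d. It is the sum of Log(1 - z e(k/d))
   over the k <= d prime to d, and grouping the k <= i by gcd(k, i) gives
   Log(1 - z^i) = sum_(d | i) L_d. By Moebius inversion |L_d| is at most
   sum_e |Log(1 - z^e)|, which is finite, so the L_d are bounded. Hence
   sum_i i^-s sum_(d | i) L_d = zeta(s) sum_d d^-s L_d with absolute convergence,
   and exponentiating (the opposite of) both sides gives the two products. *)
From HB Require Import structures.
From mathcomp Require Import all_boot all_algebra boolp.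
Require Import Defs.

Set Implicit Arguments.
Unset Strict Implicit.
Unset Printing Implicit Defensive.
Import GRing.Theory.
Local Open Scope ring_scope.

(** * Roots of unity and sums over reduced fractions *)

Lemma prod_one_sub_primitive_root (F : fieldType) (n : nat) (w x : F) :
  n.-primitive_root w -> \prod_(1 <= k < n.+1) (1 - x * w ^+ k) = 1 - x ^+ n.
Proof.
move=> wn; have n0 := prim_order_gt0 wn.
have -> : \prod_(1 <= k < n.+1) (1 - x * w ^+ k)
  = \prod_(0 <= k < n) (1 - x * w ^+ k).
  case: n n0 wn => // n _ wn.
  rewrite big_nat_recr //= [RHS]big_nat_recl //= (prim_expr_order wn) expr0 mulrC.
  by rewrite big_add1.
have [->|x0] := eqVneq x 0.
  by rewrite expr0n (gtn_eqF n0) subr0 big1 // => k _; rewrite mul0r subr0.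
have /(congr1 (fun p => x ^+ n * p.[x^-1])) := factor_Xn_sub_1 wn.
rewrite !hornerE horner_prod mulrBr mulr1 exprVn mulfV ?expf_neq0 // => <-.
rewrite -[X in x ^+ X]subn0 -prodr_const_nat -big_split /=.
by apply: eq_bigr => k _; rewrite !hornerE mulrBr mulfV.
Qed.

Lemma sum_multiples (V : nmodType) (P : pred nat) (F : nat -> V) (g n : nat) :
  (0 < g)%N ->
  \sum_(1 <= k < n.+1 | (g %| k)%N && P k) F k =
  \sum_(1 <= k < (n %/ g).+1 | P (g * k)%N) F (g * k)%N.
Proof.
move=> g0; rewrite -big_filter -[RHS]big_filter -(big_map (muln g) xpredT).
congr (\sum_(i <- _) _); apply: (irr_sorted_eq ltn_trans ltnn).
- by apply: sorted_filter; [exact: ltn_trans|exact: iota_ltn_sorted].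
- rewrite sorted_map (@eq_sorted _ _ ltn) => [|k l]; last first.
    by rewrite /= ltn_pmul2l.
  by apply: sorted_filter; [exact: ltn_trans|exact: iota_ltn_sorted].
move=> k; rewrite mem_filter mem_index_iota; apply/idP/mapP => [|[l]].
  case/andP=> /andP[/dvdnP[l ->]]; rewrite muln_gt0 !ltnS -leq_divRL //.
  move=> Pl /andP[/andP[l0 _] ln].
  exists l; last by rewrite mulnC.
  by rewrite mem_filter mem_index_iota mulnC Pl l0.
by rewrite mem_filter mem_index_iota => /and3P[Pl l0 ld] ->; rewrite dvdn_mulr //
  muln_gt0 g0 l0 Pl ltnS mulnC -leq_divRL.
Qed.

Lemma sum_coprime_divisors (V : nmodType) (f : nat -> nat -> V) (n N : nat) :
  (forall g k m, (0 < g)%N -> f (g * k)%N (g * m)%N = f k m) ->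
  (0 < n)%N -> (n <= N)%N ->
  \sum_(1 <= k < n.+1) f k n =
  \sum_(1 <= d < N.+1 | (d %| n)%N)
    \sum_(1 <= k < d.+1 | coprime k d) f k d.
Proof.
move=> fM n0 nN; symmetry.
rewrite big_mkcond /=.
have -> : \sum_(1 <= k < n.+1) f k n =
    \sum_(1 <= k < n.+1) \sum_(1 <= d < N.+1 | (n %/ gcdn k n == d)%N) f k n.
  apply: eq_big_nat => k /andP[k0 kn].
  have g0 : (0 < gcdn k n)%N by rewrite gcdn_gt0 k0.
  rewrite (big_rem (n %/ gcdn k n)%N) /=; last first.
    rewrite mem_index_iota ltnS (leq_trans (leq_div _ _) nN) andbT.
    by rewrite divn_gt0 // dvdn_leq // dvdn_gcdr.
  rewrite eqxx big1_seq ?addr0 // => d /andP[/eqP <-].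
  by rewrite mem_rem_uniqF // iota_uniq.
rewrite [RHS](exchange_big_dep xpredT) //=.
apply: eq_big_nat => d /andP[d0 dN].
case: ifPn => [dn|dn]; last first.
  rewrite big1_seq // => k /andP[/eqP dE _]; move: dn; rewrite -dE.
  by rewrite dvdn_divLR ?dvdn_gcdr ?dvdn_mulr // gcdn_gt0 n0 orbT.
have [g ng] : exists g, n = (g * d)%N by move/dvdnP: dn.
have g0 : (0 < g)%N by move: n0; rewrite ng; case: g {ng}.
transitivity (\sum_(1 <= k < (n %/ g).+1 | coprime (g * k %/ g) d) f (g * k)%N n).
  by rewrite ng mulKn //; apply: eq_big => [k|k _]; [rewrite mulKn|rewrite fM].
rewrite -(sum_multiples (fun k => coprime (k %/ g) d) (f ^~ n)) //.
rewrite [LHS]big_nat_cond [RHS]big_nat_cond /=; apply: eq_bigl => k.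
case: (boolP (1 <= k < n.+1)%N) => //= /andP[k0 _].
have G0 : (0 < gcdn k n)%N by rewrite gcdn_gt0 k0.
apply/idP/idP => [/andP[/dvdnP[l ->]]|/eqP E].
  rewrite mulnK // ng [(l * g)%N]mulnC -muln_gcdr => /eqP ->.
  by rewrite muln1 mulKn.
have G : gcdn k n = g.
  apply/eqP; rewrite -(eqn_pmul2r d0) -ng -{1}E mulnC divnK //.
  exact: dvdn_gcdr.
have gk : (g %| k)%N by rewrite -G dvdn_gcdl.
by rewrite gk /coprime -(eqn_pmul2l g0) muln_gcdr -ng mulnC divnK // G muln1 eqxx.
Qed.

(* Inclusion-exclusion over the prime divisors of n: Moebius inversion, kept in
   the form that every coefficient is 1, -1 or 0. *)
Lemma sum_coprime_signed (V : zmodType) (f : nat -> nat -> V) (n : nat) :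
  (forall g k m, (0 < g)%N -> f (g * k)%N (g * m)%N = f k m) ->
  (0 < n)%N ->
  exists P M : seq nat,
    [/\ uniq (P ++ M), {subset P ++ M <= index_iota 1 n.+1} &
        \sum_(1 <= k < n.+1 | coprime k n) f k n =
        \sum_(m <- P) \sum_(1 <= k < m.+1) f k m -
        \sum_(m <- M) \sum_(1 <= k < m.+1) f k m].
Proof.
move=> fM n0.
suff sieve (ps : seq nat) j : uniq ps -> all prime ps -> (0 < j)%N ->
    all (fun p => p %| j)%N ps ->
    exists P M : seq nat,
      [/\ uniq (P ++ M),
        {in P ++ M, forall m, (m %| j)%N && all (mem ps) (primes (j %/ m))} &
        \sum_(1 <= k < j.+1 | all (fun p => ~~ (p %| k)%N) ps) f k j =
        \sum_(m <- P) \sum_(1 <= k < m.+1) f k m -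
        \sum_(m <- M) \sum_(1 <= k < m.+1) f k m].
  have [||P [M [uPM dPM E]]] := sieve (primes n) n (primes_uniq n) _ n0.
  - by apply/allP => p; rewrite mem_primes => /andP[].
  - by apply/allP => p; rewrite mem_primes => /and3P[].
  exists P, M; split => // [m /dPM /andP[mn _]|].
    by rewrite mem_index_iota ltnS (dvdn_gt0 n0 mn) dvdn_leq.
  rewrite -E; rewrite big_nat_cond [RHS]big_nat_cond; apply: eq_bigl => k.
  case: (boolP (1 <= k < n.+1)%N) => //= /andP[k0 _].
  rewrite coprime_has_primes // -all_predC.
  apply: eq_in_all => p; rewrite mem_primes => /andP[pp _] /=.
  by rewrite mem_primes pp k0.
elim: ps j => [|p ps IH] j /=.
  move=> _ _ j0 _; exists [:: j], [::]; split => //=.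
    by move=> m; rewrite inE => /eqP->; rewrite dvdnn divnn j0.
  by rewrite big_nil subr0 big_seq1.
move=> /andP[pps ups] /andP[pp aps] j0 /andP[pj aj].
have p0 := prime_gt0 pp.
have [P [M [uPM dPM E]]] := IH j ups aps j0 aj.
have jp0 : (0 < j %/ p)%N by rewrite divn_gt0 // dvdn_leq.
have pNps q : q \in ps -> coprime q p.
  move=> qps; have pq := allP aps q qps; rewrite prime_coprime // dvdn_prime2 //.
  by apply/negP => /eqP qp; move: pps; rewrite -qp qps.
have ajp : all (fun q => q %| j %/ p)%N ps.
  apply/allP => r rps; rewrite -(Gauss_dvdl _ (pNps r rps)) divnK //.
  exact: (allP aj).
have [P' [M' [uPM' dPM' E']]] := IH (j %/ p)%N ups aps jp0 ajp.
have pm m : (m %| j %/ p)%N -> (m %| j)%N && (p %| j %/ m)%N.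
  move=> mj; have mj' := dvdn_trans mj (dvdn_div pj).
  rewrite mj' /= dvdn_divRL // mulnC -dvdn_divRL //.
exists (P ++ M'), (M ++ P'); split.
- have : perm_eq ((P ++ M') ++ M ++ P') ((P ++ M) ++ P' ++ M').
    rewrite -!catA perm_cat2l perm_catC -!catA perm_cat2l.
    by [].
  move/perm_uniq ->; rewrite cat_uniq uPM uPM' andbT /=.
  apply/hasPn => m /dPM' /andP[/pm /andP[mj pjm] _] /=.
  apply: contra pps => /dPM /andP[_ /allP]; apply.
  by rewrite mem_primes pp pjm divn_gt0 ?(dvdn_gt0 j0 mj) // dvdn_leq.
- move=> m mPM.
  have : (m \in P ++ M) || (m \in P' ++ M').
    by move: mPM; rewrite !mem_cat; do 4!case: (m \in _).
  case/orP => [/dPM|/dPM'] /andP[mj /allP a].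
    by rewrite mj; apply/allP => q /a qps; apply/orP; right.
  have /andP[mj' pjm] := pm _ mj; rewrite mj'; apply/allP => q.
  rewrite /= inE; have [//|qp /= qjm] := eqVneq q p; apply: a.
  have m0 := dvdn_gt0 j0 mj'.
  move: qjm; rewrite !mem_primes => /and3P[pq _ qjm]; rewrite pq.
  rewrite divn_gt0 // dvdn_leq //=.
  have : (q %| p * (j %/ p %/ m))%N by rewrite divnAC mulnC divnK.
  by rewrite Gauss_dvdr // prime_coprime // dvdn_prime2.
rewrite !big_cat /= opprD addrACA -E -[X in _ + X]opprB -E'.
rewrite [in RHS](bigID (dvdn p)) /=.
have -> : \sum_(1 <= k < j.+1 | all (fun q => ~~ (q %| k)%N) ps && (p %| k)%N)
    f k j = \sum_(1 <= k < (j %/ p).+1 | all (fun q => ~~ (q %| k)%N) ps)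
    f k (j %/ p)%N.
  have {2}-> : j = (p * (j %/ p))%N by rewrite mulnC divnK.
  under eq_bigl => k do rewrite andbC.
  rewrite sum_multiples //; apply: eq_big => [k|k _]; last exact: fM.
  by apply: eq_in_all => q qps; rewrite Gauss_dvdr ?pNps.
by rewrite [X in X - _]addrC addrK; apply: eq_bigl => k; rewrite andbC.
Qed.

From Stdlib Require Import Reals Ranalysis5 Lra ClassicalEpsilon.
From Coquelicot Require Import Coquelicot.
Delimit Scope nat_scope with N.
Local Open Scope R_scope.
Local Open Scope C_scope.

(** * The principal logarithm *)

Lemma cos_eq1_small (x : R) : (Rabs x < 2 * PI)%R -> cos x = 1%R -> x = 0%R.
Proof.
have aux y : (0 < y < 2 * PI)%R -> cos y <> 1%R.
  move=> y0 cy; have := cos_2a_sin (y / 2).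
  replace (2 * (y / 2))%R with y by field; rewrite cy.
  have := @sin_gt_0 (y / 2) ltac:(lra) ltac:(lra); nra.
move=> /Rabs_def2 xpi cx; case: (Rtotal_order x 0) => [x0|[//|x0]].
  by case: (aux (- x)%R); [lra|rewrite cos_neg].
by case: (aux x); [lra|].
Qed.

Lemma Cexp_add (u v : C) : Cexp (u + v) = Cexp u * Cexp v.
Proof.
rewrite /Cexp /Cmult /= exp_plus cos_plus sin_plus.
by congr pair; rewrite /Re /Im /=; ring.
Qed.

Lemma Cexp_0 : Cexp 0 = 1.
Proof. by rewrite /Cexp /= exp_0 cos_0 sin_0 !Rmult_1_l. Qed.

Lemma Cexp_opp (u : C) : Cexp u * Cexp (- u) = 1.
Proof. by rewrite -Cexp_add Cplus_opp_r Cexp_0. Qed.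

Lemma Cexp_eq1_small (w : C) :
  Cexp w = 1 -> (Rabs (Im w) < 2 * PI)%R -> w = 0.
Proof.
case: w => x y; rewrite /Cexp /Im /= => -[Ec Es] ypi.
have x1 : exp x = 1%R.
  have := exp_pos x; have := sin2_cos2 y; rewrite /Rsqr.
  have : (exp x * exp x * (sin y * sin y + cos y * cos y) = 1)%R.
    transitivity ((exp x * sin y) * (exp x * sin y) +
      (exp x * cos y) * (exp x * cos y))%R; first by ring.
    by rewrite Es Ec; ring.
  move=> E1 E2; rewrite E2 in E1; nra.
have x0 : x = 0%R by apply: exp_inv; rewrite exp_0.
rewrite x1 Rmult_1_l in Ec.
by rewrite x0 (cos_eq1_small ypi Ec).
Qed.

Lemma Re_le_Cmod (w : C) : (Rabs (Re w) <= Cmod w)%R.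
Proof.
have := Rmax_Cmod w; have := Rmax_l (Rabs w.1) (Rabs w.2).
by rewrite /Re; lra.
Qed.

Lemma Im_le_Cmod (w : C) : (Rabs (Im w) <= Cmod w)%R.
Proof.
have := Rmax_Cmod w; have := Rmax_r (Rabs w.1) (Rabs w.2).
by rewrite /Im; lra.
Qed.

Lemma Cmod_le_Re_Im (w : C) : (Cmod w <= Rabs (Re w) + Rabs (Im w))%R.
Proof.
case: w => x y; rewrite /Re /Im /=.
have -> : (x, y) = RtoC x + (RtoC y) * Ci.
  by rewrite /RtoC /Cplus /Cmult /=; congr pair; ring.
apply: Rle_trans (Cmod_triangle _ _) _.
by rewrite Cmod_mult Cmod_Ci !Cmod_R; lra.
Qed.

Lemma Cmod_sqr (w : C) : (Cmod w * Cmod w = Re w * Re w + Im w * Im w)%R.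
Proof.
rewrite /Cmod sqrt_sqrt /Re /Im; first by ring.
by have := pow2_ge_0 w.1; have := pow2_ge_0 w.2; lra.
Qed.

Lemma Re_pos_Cmod (w : C) : (0 < Re w)%R -> (0 < Cmod w)%R.
Proof. by move=> w0; have := Re_le_Cmod w; rewrite Rabs_pos_eq; lra. Qed.

Lemma sqrt_one_add_tan (w : C) : (0 < Re w)%R ->
  sqrt (1 + (Im w / Re w)²) = (Cmod w / Re w)%R.
Proof.
move=> w0; have m0 := Re_pos_Cmod w0; apply: sqrt_lem_1.
- by have := Rle_0_sqr (Im w / Re w); lra.
- by apply: Rlt_le; apply: Rdiv_lt_0_compat.
rewrite /Rsqr; have := Cmod_sqr w => E.
apply: (Rmult_eq_reg_r (Re w * Re w)%R); last by nra.
by field_simplify; try lra; rewrite /= !Rmult_1_r -E; ring.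
Qed.

Lemma Carg_atan (w : C) : (0 < Re w)%R -> Carg w = atan (Im w / Re w).
Proof.
move=> w0; have m0 := Re_pos_Cmod w0; have E := Cmod_sqr w.
have q0 : (0 < Re w / Cmod w)%R by apply: Rdiv_lt_0_compat.
have S : sqrt (1 - (Re w / Cmod w)²) = (Rabs (Im w) / Cmod w)%R.
  have -> : (1 - (Re w / Cmod w)² = (Im w / Cmod w)²)%R.
    rewrite /Rsqr; apply: (Rmult_eq_reg_r (Cmod w * Cmod w)%R); last by nra.
    by field_simplify; try lra; rewrite /= !Rmult_1_r E; ring.
  by rewrite sqrt_Rsqr_abs Rabs_div ?(Rabs_pos_eq (Cmod w)); lra.
have A : acos (Re w / Cmod w) = atan (Rabs (Im w) / Re w).
  by rewrite acos_atan // S; congr atan; field; lra.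
rewrite /Carg A; case: Rle_dec => y0.
  by rewrite Rabs_pos_eq.
rewrite -atan_opp Rabs_left; last lra.
by congr atan; field; lra.
Qed.

Lemma Cexp_Clog (w : C) : (0 < Re w)%R -> Cexp (Clog w) = w.
Proof.
move=> w0; have m0 := Re_pos_Cmod w0.
rewrite /Cexp /Clog /= Carg_atan // exp_ln // cos_atan sin_atan.
rewrite sqrt_one_add_tan // [RHS]surjective_pairing -/(Re w) -/(Im w).
by congr pair; field; lra.
Qed.

Lemma Clog_mult (u v : C) : (0 < Re u)%R -> (0 < Re v)%R -> (0 < Re (u * v))%R ->
  Clog (u * v) = Clog u + Clog v.
Proof.
move=> u0 v0 uv0; apply/esym/Ceq_minus/Cexp_eq1_small.
  rewrite /Cminus !Cexp_add !Cexp_Clog // -{1}(Cexp_Clog uv0).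
  exact: Cexp_opp.
rewrite /Clog /Im /= !Carg_atan //.
have := atan_bound (Im u / Re u); have := atan_bound (Im v / Re v).
have := atan_bound (Im (u * v) / Re (u * v)); have := PI_RGT_0.
by move=> *; apply: Rabs_def1; lra.
Qed.

Lemma atan_mvt (v : R) :
  exists c : R, (Rabs c <= Rabs v)%R /\ (atan v = v / (1 + c * c))%R.
Proof.
have [|x _|c [Hc]] := @MVT_gen atan 0 v (fun x => / (1 + x²))%R.
- by move=> *; apply: is_derive_atan.
- by apply: derivable_continuous_pt; apply: derivable_pt_atan.
rewrite atan_0 !Rminus_0_r => ->; exists c; split; last first.
  by rewrite /Rsqr /Rdiv Rmult_comm.
move: Hc; rewrite /Rmin /Rmax; case: Rle_dec => ? ?.
  by rewrite !Rabs_pos_eq; lra.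
by rewrite !Rabs_left1; lra.
Qed.

Lemma atan_le (v : R) : (Rabs (atan v) <= Rabs v)%R.
Proof.
have [c [_ ->]] := atan_mvt v; have c1 : (1 <= 1 + c * c)%R by nra.
rewrite Rabs_div ?(Rabs_pos_eq (1 + c * c)); try lra.
apply: (Rmult_le_reg_r (1 + c * c)); first lra.
replace (Rabs v / (1 + c * c) * (1 + c * c))%R with (Rabs v) by (field; lra).
by have := Rabs_pos v; nra.
Qed.

Lemma atan_sub_bound (v : R) : (Rabs (atan v - v) <= v * v)%R.
Proof.
have [c [cv ->]] := atan_mvt v; have c1 : (0 < 1 + c * c)%R by nra.
replace (v / (1 + c * c) - v)%R with (- (v * (c * c / (1 + c * c))))%R
  by (field; lra).
rewrite Rabs_Ropp Rabs_mult (Rabs_pos_eq (c * c / _)); last first.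
  by apply: Rdiv_le_0_compat => //; nra.
have -> : (v * v = Rabs v * Rabs v)%R by rewrite -Rabs_mult Rabs_pos_eq; nra.
apply: Rmult_le_compat_l; first exact: Rabs_pos.
apply: Rle_trans cv; apply: (Rmult_le_reg_r (1 + c * c)) => //.
replace (c * c / (1 + c * c) * (1 + c * c))%R with (c * c)%R by (field; lra).
have -> : (c * c = Rabs c * Rabs c)%R by rewrite -Rabs_mult Rabs_pos_eq; nra.
by have := Rabs_pos c; nra.
Qed.

Lemma ln_ge (t : R) : (0 < t)%R -> (1 - / t <= ln t)%R.
Proof.
move=> t0; have := exp_ineq1_le (- ln t).
by rewrite exp_Ropp exp_ln //; lra.
Qed.

Lemma ln_le_sub1 (t : R) : (0 < t)%R -> (ln t <= t - 1)%R.
Proof. by move=> t0; have := exp_ineq1_le (ln t); rewrite exp_ln //; lra. Qed.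

Lemma Clog_one_add (h : C) : (Cmod h <= / 4)%R ->
  (Cmod (Clog (1 + h) - h) <= 10 * (Cmod h * Cmod h))%R.
Proof.
move=> h4; have m0 := Cmod_ge_0 h; have mE := Cmod_sqr h.
have xm := Re_le_Cmod h; have ym := Im_le_Cmod h.
set x := Re h in mE xm *; set y := Im h in mE ym *; set m := Cmod h in h4 m0 mE xm ym *.
have {}xm : (- m <= x <= m)%R by apply/Rabs_le_between.
have {}ym : (- m <= y <= m)%R by apply/Rabs_le_between.
have Re1 : Re (1 + h) = (1 + x)%R by [].
have Im1 : Im (1 + h) = y by rewrite /Im /= Rplus_0_l.
have p1 : (0 < Re (1 + h))%R by rewrite Re1; lra.
have M0 := Re_pos_Cmod p1; have := Cmod_sqr (1 + h); rewrite Re1 Im1 => ME.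
apply: Rle_trans (Cmod_le_Re_Im _) _.
have -> : Im (Clog (1 + h) - h) = (atan (y / (1 + x)) - y)%R.
  by have := Carg_atan p1; rewrite Re1 Im1 => <-.
have -> : Re (Clog (1 + h) - h) = (/ 2 * ln (1 + (2 * x + m * m)) - x)%R.
  have -> : Re (Clog (1 + h) - h) = (ln (Cmod (1 + h)) - x)%R by [].
  have -> : (1 + (2 * x + m * m) = Cmod (1 + h) * Cmod (1 + h))%R.
    by rewrite ME mE; ring.
  by rewrite ln_mult //; field.
set t := (2 * x + m * m)%R.
have t1 : (9 / 16 <= 1 + t)%R.
  have -> : (1 + t = (1 + x) * (1 + x) + y * y)%R by rewrite /t mE; ring.
  nra.
have tm : (t * t <= 6 * (m * m))%R.
  have tb : (- (9 / 4 * m) <= t <= 9 / 4 * m)%R by rewrite /t; nra.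
  clearbody t; nra.
have U : (ln (1 + t) <= t)%R by have := @ln_le_sub1 (1 + t) ltac:(lra); lra.
have L : (t - 11 * (m * m) <= ln (1 + t))%R.
  apply: Rle_trans (ln_ge _); last lra.
  have -> : (1 - / (1 + t) = t - (t * t) / (1 + t))%R by field; lra.
  suff : (t * t / (1 + t) <= 11 * (m * m))%R by lra.
  apply: (Rmult_le_reg_r (1 + t)); first lra.
  have -> : (t * t / (1 + t) * (1 + t) = t * t)%R by field; lra.
  nra.
have RB : (Rabs (/ 2 * ln (1 + t) - x) <= 6 * (m * m))%R.
  by apply: Rabs_le; rewrite /t in U L *; nra.
set v := (y / (1 + x))%R.
have vE : (v * (1 + x) = y)%R by rewrite /v; field; lra.
have vy : (v - y = - x * v)%R by rewrite -vE; ring.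
have av : (Rabs v <= 4 / 3 * m)%R.
  apply: Rabs_le; split; apply: (Rmult_le_reg_r (1 + x)); rewrite ?vE; nra.
have IB : (Rabs (atan v - y) <= 4 * (m * m))%R.
  have -> : (atan v - y = (atan v - v) + (v - y))%R by ring.
  apply: Rle_trans (Rabs_triang _ _) _.
  have := atan_sub_bound v; rewrite vy Rabs_mult Rabs_Ropp.
  have -> : (v * v = Rabs v * Rabs v)%R by rewrite -Rabs_mult Rabs_pos_eq; nra.
  have := Rabs_pos v; have := Rabs_pos x.
  have : (Rabs x <= m)%R by apply: Rabs_le.
  nra.
lra.
Qed.

Lemma Clog_one_sub_bound (w : C) : (Cmod w < 1)%R ->
  (Cmod (Clog (1 - w)) <= 2 * (Cmod w / (1 - Cmod w)))%R.
Proof.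
move=> w1; have w0 := Cmod_ge_0 w.
have := Re_le_Cmod w; have := Im_le_Cmod w => /Rabs_le_between yw /Rabs_le_between xw.
have p : (0 < Re (1 - w))%R by rewrite /=; rewrite /Re in xw *; lra.
have m0 := Re_pos_Cmod p.
have m1 : (Cmod (1 - w) <= 1 + Cmod w)%R.
  apply: Rle_trans (Cmod_triangle _ _) _.
  by rewrite Cmod_opp Cmod_1; lra.
have m2 : (1 - Cmod w <= Cmod (1 - w))%R.
  by have := Re_le_Cmod (1 - w); rewrite Rabs_pos_eq /=; rewrite /Re in xw *; lra.
set r := Cmod w in w1 w0 xw yw m1 m2 *.
have rr : (r <= r / (1 - r))%R.
  apply: (Rmult_le_reg_r (1 - r)); first lra.
  by replace (r / (1 - r) * (1 - r))%R with r by (field; lra); nra.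
apply: Rle_trans (Cmod_le_Re_Im _) _.
have R1 : (Rabs (Re (Clog (1 - w))) <= r / (1 - r))%R.
  apply: Rabs_le; split => /=; last by have := ln_le_sub1 m0; lra.
  apply: Rle_trans (ln_ge m0).
  have : (/ Cmod (1 - w) <= / (1 - r))%R by apply: Rinv_le_contravar; lra.
  replace (/ (1 - r))%R with (1 + r / (1 - r))%R by (field; lra); lra.
suff : (Rabs (Im (Clog (1 - w))) <= r / (1 - r))%R by lra.
rewrite /Clog {1}/Im [snd _]/= Carg_atan //.
apply: Rle_trans (atan_le _) _.
have -> : Im (1 - w) = (- Im w)%R by rewrite /Im /= Rplus_0_l.
have -> : Re (1 - w) = (1 - Re w)%R by [].
rewrite Rabs_div ?Rabs_Ropp ?(Rabs_pos_eq (1 - Re w)); try lra.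
apply: Rmult_le_compat; try exact: Rabs_pos; try lra.
- by apply: Rlt_le; apply: Rinv_0_lt_compat; lra.
- exact: Im_le_Cmod.
by apply: Rinv_le_contravar; lra.
Qed.

Lemma Re_one_sub_pos (w : C) : (Cmod w < 1)%R -> (0 < Re (1 - w))%R.
Proof.
move=> w1; have := Re_le_Cmod w => /Rabs_le_between.
by have -> : Re (1 - w) = (1 - Re w)%R by []; lra.
Qed.

(* The field structure on C is used to factor X^n - 1. *)
HB.instance Definition _ := gen_eqMixin C.
HB.instance Definition _ := gen_choiceMixin C.

Lemma Cplus_opp_l (x : C) : - x + x = 0.
Proof. by rewrite Cplus_comm Cplus_opp_r. Qed.

HB.instance Definition _ := GRing.isZmodule.Build C
  Cplus_assoc Cplus_comm Cplus_0_l Cplus_opp_l.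

Lemma C1_neq0 : RtoC 1 != RtoC 0.
Proof. by apply/eqP; exact: C1_nz. Qed.

HB.instance Definition _ := GRing.Zmodule_isComNzRing.Build C
  Cmult_assoc Cmult_comm Cmult_1_l Cmult_plus_distr_r C1_neq0.

Lemma CmulVf (x : C) : x != RtoC 0 -> Cinv x * x = 1.
Proof. by move/eqP; exact: Cinv_l. Qed.

Lemma Cinv0 : Cinv (RtoC 0) = RtoC 0.
Proof. by rewrite /Cinv /RtoC /= Ropp_0 /Rdiv !Rmult_0_l. Qed.

HB.instance Definition _ := GRing.ComNzRing_isField.Build C CmulVf Cinv0.

HB.instance Definition _ := Monoid.isComLaw.Build C (RtoC 0) Cplus
  Cplus_assoc Cplus_comm Cplus_0_l.

(** * Logarithms on the unit disc *)

Lemma ex_derive_quadratic (f : C -> C) (x l : C) (d K : R) :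
  (0 < d)%R -> (0 <= K)%R ->
  (forall y, (Cmod (y - x) < d)%R ->
    (Cmod (f y - f x - (y - x) * l) <= K * (Cmod (y - x) * Cmod (y - x)))%R) ->
  @ex_derive C_AbsRing C_NormedModule f x.
Proof.
move=> d0 K0 H; exists l; split; first exact: is_linear_scal_l.
move=> x' Hx' eps.
have <- := is_filter_lim_locally_unique _ _ Hx'.
have e0 : (0 < Rmin d (eps / (K + 1)))%R.
  by apply: Rmin_pos => //; apply: Rdiv_lt_0_compat; [case: eps|lra].
exists (mkposreal _ e0) => y; rewrite /ball /= /AbsRing_ball /abs /= => yx.
have yd : (Cmod (y - x) < d)%R by apply: Rlt_le_trans yx (Rmin_l _ _).
have ye : (Cmod (y - x) < eps / (K + 1))%R by apply: Rlt_le_trans yx (Rmin_r _ _).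
apply: Rle_trans (H y yd) _; rewrite -Rmult_assoc.
apply: Rmult_le_compat_r; first exact: Cmod_ge_0.
have := Cmod_ge_0 (y - x).
have : (Cmod (y - x) * (K + 1) < eps)%R.
  have -> : (pos eps = eps / (K + 1) * (K + 1))%R by field; lra.
  by apply: Rmult_lt_compat_r; lra.
by nra.
Qed.

Lemma ex_derive_Clog_affine (a z : C) : (Cmod a <= 1)%R -> (Cmod z < 1)%R ->
  @ex_derive C_AbsRing C_NormedModule (fun z => Clog (1 - z * a)) z.
Proof.
move=> a1 z1; set q := (1 - Cmod z)%R; have q0 : (0 < q)%R by rewrite /q; lra.
have Re_pos w : (Cmod w < 1)%R -> (0 < Re (1 - w * a))%R.
  move=> w1; have wa1 : (Cmod (w * a) < 1)%R.
    by rewrite Cmod_mult; have := Cmod_ge_0 w; have := Cmod_ge_0 a; nra.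
  exact: Re_one_sub_pos.
have uq : (q <= Cmod (1 - z * a))%R.
  have := Cmod_triangle (1 - z * a) (z * a).
  have -> : 1 - z * a + z * a = 1 by ring.
  rewrite Cmod_1 Cmod_mult /q.
  by have := Cmod_ge_0 z; have := Cmod_ge_0 a; nra.
have u0 : 1 - z * a <> 0 by move=> E; rewrite E Cmod_0 in uq; lra.
apply: (@ex_derive_quadratic _ z (- a / (1 - z * a)) (q / 4) (10 / (q * q))).
- by lra.
- by apply: Rlt_le; apply: Rdiv_lt_0_compat; nra.
move=> y yz; set h := (y - z) * (- a / (1 - z * a)).
have hm : (Cmod h <= Cmod (y - z) / q)%R.
  rewrite /h Cmod_mult; apply: Rmult_le_compat_l; first exact: Cmod_ge_0.
  rewrite Cmod_div // Cmod_opp -[X in (_ <= X)%R]Rmult_1_l.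
  apply: Rmult_le_compat => //; first exact: Cmod_ge_0.
    by apply: Rlt_le; apply: Rinv_0_lt_compat; lra.
  by apply: Rinv_le_contravar.
have h4 : (Cmod h <= / 4)%R.
  apply: Rle_trans hm _; apply: (Rmult_le_reg_r q) => //.
  by replace (Cmod (y - z) / q * q)%R with (Cmod (y - z)) by (field; lra); lra.
have y1 : (Cmod y < 1)%R.
  have -> : y = z + (y - z) by ring.
  by apply: Rle_lt_trans (Cmod_triangle _ _) _; rewrite /q in yz; lra.
have yE : 1 - y * a = (1 - z * a) * (1 + h) by rewrite /h; field.
have hp : (0 < Re (1 + h))%R.
  have := Re_le_Cmod h => /Rabs_le_between.
  by have -> : Re (1 + h) = (1 + Re h)%R by []; lra.
rewrite yE Clog_mult // -?yE; try exact: Re_pos.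
have -> : Clog (1 - z * a) + Clog (1 + h) - Clog (1 - z * a) - h = Clog (1 + h) - h.
  by ring.
apply: Rle_trans (Clog_one_add h4) _.
have -> : (10 / (q * q) * (Cmod (y - z) * Cmod (y - z)) =
  10 * ((Cmod (y - z) / q) * (Cmod (y - z) / q)))%R by field; lra.
by have := Cmod_ge_0 h; nra.
Qed.

Lemma ex_derive_Csum (I : Type) (r : seq I) (P : pred I) (F : I -> C -> C) (z : C) :
  (forall i, @ex_derive C_AbsRing C_NormedModule (F i) z) ->
  @ex_derive C_AbsRing C_NormedModule
    (fun z => \big[Cplus/RtoC 0]_(i <- r | P i) F i z) z.
Proof.
move=> dF; elim: r => [|i r IH].
  by apply: ex_derive_ext (ex_derive_const (RtoC 0) z) => t; rewrite big_nil.
case Pi : (P i); last first.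
  by apply: ex_derive_ext IH => t; rewrite big_cons Pi.
apply: ex_derive_ext (ex_derive_plus _ _ _ (dF i) IH) => t.
by rewrite big_cons Pi.
Qed.

Lemma Cexp_Csum (I : Type) (r : seq I) (P : pred I) (F : I -> C) :
  Cexp (\big[Cplus/RtoC 0]_(i <- r | P i) F i) =
  \big[Cmult/RtoC 1]_(i <- r | P i) Cexp (F i).
Proof. exact: (big_morph Cexp Cexp_add Cexp_0). Qed.

Lemma continuity_pt_ray (f : C -> C) (z : C) (t : R) :
  @ex_derive C_AbsRing C_NormedModule f (t * z) ->
  continuity_pt (fun t : R => Im (f (t * z))) t.
Proof.
move=> df; apply/continuity_pt_filterlim.
have cf := ex_derive_continuous _ _ df.
apply: (filterlim_comp _ _ _ (fun t : R => f (RtoC t * z)) Im _ (locally (f (t * z)))).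
  apply: (filterlim_comp _ _ _ (fun t : R => RtoC t * z) f _
    (@locally (AbsRing_UniformSpace C_AbsRing) (RtoC t * z))) => //.
  move=> Q [eps HQ].
  have e0 : (0 < eps / (Cmod z + 1))%R.
    by apply: Rdiv_lt_0_compat; [apply: cond_pos|have := Cmod_ge_0 z; lra].
  exists (mkposreal _ e0) => u; rewrite /ball /= /AbsRing_ball /abs /= => ut.
  apply: HQ; change (Cmod (RtoC u * z - RtoC t * z) < eps)%R.
  have -> : RtoC u * z - RtoC t * z = RtoC (u - t) * z.
    by rewrite RtoC_minus; ring.
  rewrite Cmod_mult Cmod_R; have z0 := Cmod_ge_0 z.
  have : (Rabs (u - t) * (Cmod z + 1) < eps)%R.
    have -> : (pos eps = eps / (Cmod z + 1) * (Cmod z + 1))%R by field; lra.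
    by apply: Rmult_lt_compat_r => //; lra.
  by have := Rabs_pos (u - t); nra.
exact: continuous_snd.
Qed.

Lemma continuous_isolated_zero (g : R -> R) (e : R) :
  (0 < e)%R -> (forall t, (0 <= t <= 1)%R -> continuity_pt g t) -> g 0%R = 0%R ->
  (forall t, (0 <= t <= 1)%R -> (Rabs (g t) < e)%R -> g t = 0%R) -> g 1%R = 0%R.
Proof.
move=> e0.
have aux (h : R -> R) : (forall t, (0 <= t <= 1)%R -> continuity_pt h t) ->
    h 0%R = 0%R ->
    (forall t, (0 <= t <= 1)%R -> (Rabs (h t) < e)%R -> h t = 0%R) ->
    ~ (0 < h 1)%R.
  move=> hc h0 hz h1; set c := Rmin (h 1%R / 2) (e / 2).
  have c0 : (0 < c)%R by apply: Rmin_pos; lra.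
  have c1 : (c <= h 1 / 2)%R by apply: Rmin_l.
  have ce : (c <= e / 2)%R by apply: Rmin_r.
  have [|||| x [x01 xc]] := @IVT_interv (fun t => h t - c)%R 0 1; try lra.
    move=> t t01; apply: continuity_pt_minus; first exact: hc.
    by apply: continuity_pt_const => ? ?.
  have := hz x x01; rewrite Rabs_pos_eq; lra.
move=> gc g0 gz; have [g1|[//|g1]] := Rtotal_order (g 1%R) 0; last first.
  by case: (aux g).
case: (aux (fun t => - g t)%R); last lra.
- by move=> t t01; apply: continuity_pt_opp; apply: gc.
- lra.
- by move=> t t01; rewrite Rabs_Ropp => /gz->; lra.
Qed.

Lemma continuous_log_unique (f g : C -> C) (z : C) : (Cmod z < 1)%R ->
  (forall t, (0 <= t <= 1)%R -> continuity_pt (fun t : R => Im (f (t * z))) t) ->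
  (forall t, (0 <= t <= 1)%R -> continuity_pt (fun t : R => Im (g (t * z))) t) ->
  (forall w, (Cmod w < 1)%R -> Cexp (f w) = Cexp (g w)) ->
  f 0 = 0 -> g 0 = 0 -> f z = g z.
Proof.
move=> z1 cf cg fg f0 g0.
have E w : (Cmod w < 1)%R -> Cexp (f w - g w) = 1.
  by move=> w1; rewrite Cexp_add fg // Cexp_opp.
have disc t : (0 <= t <= 1)%R -> (Cmod (t * z) < 1)%R.
  by move=> t01; rewrite Cmod_mult Cmod_R Rabs_pos_eq; have := Cmod_ge_0 z; nra.
have I0 : Im (f z - g z) = 0%R.
  have -> : Im (f z - g z) = (Im (f (1 * z)%C) - Im (g (1 * z)%C))%R.
    by rewrite !Cmult_1_l.
  apply: (@continuous_isolated_zero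
    (fun t : R => Im (f (t * z)%C) - Im (g (t * z)%C))%R (2 * PI)).
  - by have := PI_RGT_0; lra.
  - by move=> t t01; apply: continuity_pt_minus; [exact: cf|exact: cg].
  - by rewrite Cmult_0_l f0 g0 Rminus_diag.
  move=> t t01; rewrite -[(_ - _)%R]/(Im (f (t * z) - g (t * z))) => small.
  by rewrite (Cexp_eq1_small (E _ (disc t t01)) small).
apply/Ceq_minus/Cexp_eq1_small; first exact: E.
by rewrite I0 Rabs_R0; have := PI_RGT_0; lra.
Qed.

Definition root_frac (k n : nat) : C := Cexp (2 * PI * Ci * (INR k / INR n)).

Lemma root_fracE (k n : nat) : (0 < n)%N ->
  root_frac k n = Cexp (0, 2 * PI * (INR k / INR n))%R.
Proof.
move=> n0; rewrite /root_frac -RtoC_div; last first.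
  by apply: not_0_INR => E; rewrite E in n0.
by congr Cexp; rewrite /Cmult /RtoC /=; congr pair; ring.
Qed.

Lemma Cmod_root_frac (k n : nat) : (0 < n)%N -> Cmod (root_frac k n) = 1%R.
Proof.
move=> n0; rewrite root_fracE // /Cexp /= exp_0 !Rmult_1_l /Cmod /=.
rewrite !Rmult_1_r; have := sin2_cos2 (2 * PI * (INR k / INR n)).
by rewrite /Rsqr Rplus_comm => ->; exact: sqrt_1.
Qed.

(* For n = 0 both fractions are x / 0 = 0. *)
Lemma root_frac_scale (g k n : nat) :
  (0 < g)%N -> root_frac (g * k)%N (g * n)%N = root_frac k n.
Proof.
move=> g0; rewrite /root_frac; congr (Cexp (_ * _)).
have gR : INR g <> 0%R by apply: not_0_INR => gE; rewrite gE in g0.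
case: n => [|n].
  by rewrite muln0 /Cdiv Cinv0 !Cmult_0_r.
have nR : INR n.+1 <> 0%R by exact: not_0_INR.
rewrite !mult_INR !RtoC_mult; field.
by split=> /RtoC_inj.
Qed.

Lemma exprE_Cpow (w : C) (n : nat) : GRing.exp w n = w ^ n.
Proof. by elim: n => [|n IH]; rewrite ?expr0 // exprS IH. Qed.

Lemma root_frac_pow (k n : nat) : (0 < n)%N -> root_frac k n = root_frac 1 n ^ k.
Proof.
move=> n0; elim: k => [|k IH].
  by rewrite root_fracE // /Rdiv Rmult_0_l Rmult_0_r Cexp_0.
rewrite Cpow_S -IH !root_fracE // -Cexp_add; congr Cexp.
rewrite S_INR /Cplus /=; congr pair; first by ring.
by field; apply: not_0_INR => E; rewrite E in n0.
Qed.

Lemma root_frac_primitive (n : nat) : (0 < n)%N ->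
  primitive_root_of_unity n (root_frac 1 n).
Proof.
move=> n0; have nR : (0 < INR n)%R by apply: lt_0_INR; apply/ltP.
have pi0 := PI_RGT_0.
rewrite /primitive_root_of_unity n0; apply/forallP => -[i /= ilt].
rewrite unity_rootE exprE_Cpow -root_frac_pow //; apply/eqP.
rewrite root_fracE //; apply/idP/idP => [/eqP E|/eqP ->]; last first.
  rewrite /Rdiv Rinv_r; last lra.
  by apply/eqP; rewrite Rmult_1_r /Cexp /= exp_0 cos_2PI sin_2PI !Rmult_1_l.
rewrite eqn_leq ilt /= leqNgt; apply/negP => /ltP/lt_INR lt.
have q1 : (INR i.+1 / INR n < 1)%R.
  apply: (Rmult_lt_reg_r (INR n)) => //.
  replace (INR i.+1 / INR n * INR n)%R with (INR i.+1) by (field; lra).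
  lra.
have q0 : (0 < INR i.+1 / INR n)%R.
  by apply: Rdiv_lt_0_compat => //; apply: lt_0_INR; apply/ltP.
move: E q0 q1; set q := (INR _ / INR n)%R => E q0 q1.
have qpi : (0 < 2 * PI * q < 2 * PI)%R by clearbody q; nra.
have := Cexp_eq1_small E; rewrite /Im [snd _]/= Rabs_pos_eq; last by lra.
by move=> /(_ (proj2 qpi)) /(congr1 snd) /= ?; lra.
Qed.

Lemma prod_one_sub_root_frac (n : nat) (z : C) : (0 < n)%N ->
  \big[Cmult/RtoC 1]_(1 <= k < n.+1) (1 - z * root_frac k n) = 1 - z ^ n.
Proof.
move=> n0; rewrite -exprE_Cpow.
rewrite -[RHS](prod_one_sub_primitive_root z (root_frac_primitive n0)).
by apply: eq_bigr => k _; rewrite root_frac_pow // exprE_Cpow.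
Qed.

Lemma Clog_1 : Clog 1 = 0.
Proof.
by rewrite /Clog Cmod_1 ln_1 Carg_atan /=; [rewrite /Rdiv Rmult_0_l atan_0|lra].
Qed.

Lemma Cmod_mul_root_frac (z : C) (k n : nat) :
  (0 < n)%N -> Cmod (z * root_frac k n) = Cmod z.
Proof. by move=> n0; rewrite Cmod_mult Cmod_root_frac // Rmult_1_r. Qed.

Lemma Cexp_sum_Clog (n : nat) (P : pred nat) (z : C) : (0 < n)%N -> (Cmod z < 1)%R ->
  Cexp (\big[Cplus/RtoC 0]_(1 <= k < n.+1 | P k) Clog (1 - z * root_frac k n)) =
  \big[Cmult/RtoC 1]_(1 <= k < n.+1 | P k) (1 - z * root_frac k n).
Proof.
move=> n0 z1; rewrite Cexp_Csum; apply: eq_bigr => k _.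
by apply/Cexp_Clog/Re_one_sub_pos; rewrite Cmod_mul_root_frac.
Qed.

Lemma ex_derive_sum_Clog (n : nat) (P : pred nat) (z : C) :
  (0 < n)%N -> (Cmod z < 1)%R ->
  @ex_derive C_AbsRing C_NormedModule (fun z =>
    \big[Cplus/RtoC 0]_(1 <= k < n.+1 | P k) Clog (1 - z * root_frac k n)) z.
Proof.
move=> n0 z1; apply: ex_derive_Csum => k; apply: ex_derive_Clog_affine => //.
by rewrite Cmod_root_frac //; lra.
Qed.

Lemma sum_Clog_0 (n : nat) (P : pred nat) :
  \big[Cplus/RtoC 0]_(1 <= k < n.+1 | P k) Clog (1 - 0 * root_frac k n) = 0.
Proof.
apply: big1 => k _; rewrite Cmult_0_l.
have -> : 1 - 0 = 1 by ring.
exact: Clog_1.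
Qed.

Lemma Cmod_ray (z : C) (t : R) : (Cmod z < 1)%R -> (0 <= t <= 1)%R ->
  (Cmod (t * z) < 1)%R.
Proof.
by move=> z1 t01; rewrite Cmod_mult Cmod_R Rabs_pos_eq; have := Cmod_ge_0 z; nra.
Qed.

Lemma disc_log_cyclo_hat (n : nat) (z : C) : (0 < n)%N -> (Cmod z < 1)%R ->
  disc_log (cyclo_hat n) z =
  \big[Cplus/RtoC 0]_(1 <= k < n.+1 | coprime k n) Clog (1 - z * root_frac k n).
Proof.
move=> n0 z1.
have L : is_disc_log (cyclo_hat n) (fun z => \big[Cplus/RtoC 0]_(1 <= k < n.+1
    | coprime k n) Clog (1 - z * root_frac k n)).
  split; first by move=> w w1; apply: ex_derive_sum_Clog.
  by split=> [w w1|]; [apply: Cexp_sum_Clog|apply: sum_Clog_0].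
have [dL [eL L0]] := epsilon_spec (inhabits (fun _ : C => RtoC 0))
  (is_disc_log (cyclo_hat n)) (ex_intro _ _ L).
apply: (continuous_log_unique (f := disc_log (cyclo_hat n)) (g := fun z =>
  \big[Cplus/RtoC 0]_(1 <= k < n.+1 | coprime k n) Clog (1 - z * root_frac k n))) => //.
- move=> t t01; apply: (continuity_pt_ray (f := disc_log (cyclo_hat n))).
  by apply: dL; apply: Cmod_ray.
- by move=> t t01; exact: continuity_pt_ray (ex_derive_sum_Clog _ n0 (Cmod_ray z1 t01)).
- by move=> w w1; rewrite eL // Cexp_sum_Clog.
exact: sum_Clog_0.
Qed.

Lemma RtoC_pow (x : R) (n : nat) : RtoC (x ^ n)%R = RtoC x ^ n.
Proof. by elim: n => // n IH; rewrite Cpow_S -IH -RtoC_mult. Qed.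

Lemma Cmod_pow_lt1 (z : C) (n : nat) :
  (0 < n)%N -> (Cmod z < 1)%R -> (Cmod (z ^ n) < 1)%R.
Proof.
move=> n0 z1; rewrite Cmod_pow.
have z01 : (0 <= Cmod z < 1)%R by split=> //; exact: Cmod_ge_0.
by case: (pow_lt_1_compat _ n z01 (ltP n0)).
Qed.

Lemma Clog_one_sub_pow (n : nat) (z : C) : (0 < n)%N -> (Cmod z < 1)%R ->
  Clog (1 - z ^ n) =
  \big[Cplus/RtoC 0]_(1 <= k < n.+1) Clog (1 - z * root_frac k n).
Proof.
move=> n0 z1.
apply: (continuous_log_unique (f := fun z => Clog (1 - z ^ n)) (g := fun z =>
  \big[Cplus/RtoC 0]_(1 <= k < n.+1) Clog (1 - z * root_frac k n))) => //.
- move=> t t01; have zn1 := Cmod_pow_lt1 n0 z1.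
  apply: (continuity_pt_ext (comp (fun s : R => Im (Clog (1 - (s * z ^ n) * 1)))
    (fun t : R => (t ^ n)%R))).
    by move=> u; rewrite /comp Cmult_1_r Cpow_mult_l RtoC_pow.
  apply: continuity_pt_comp.
    by apply: derivable_continuous_pt; apply: derivable_pt_pow.
  apply: (continuity_pt_ray (f := fun w => Clog (1 - w * 1))).
  apply: ex_derive_Clog_affine; first by rewrite Cmod_1; lra.
  rewrite RtoC_pow -Cpow_mult_l; apply: Cmod_pow_lt1 => //; exact: Cmod_ray.
- by move=> t t01; exact: continuity_pt_ray (ex_derive_sum_Clog _ n0 (Cmod_ray z1 t01)).
- move=> w w1; rewrite Cexp_sum_Clog // prod_one_sub_root_frac //.
  by apply/Cexp_Clog/Re_one_sub_pos/Cmod_pow_lt1.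
- case: n n0 => // n _; rewrite Cpow_S Cmult_0_l.
  have -> : 1 - 0 = 1 by ring.
  exact: Clog_1.
exact: sum_Clog_0.
Qed.

(** * Summation *)

HB.instance Definition _ := Monoid.isComLaw.Build R 0%R Rplus
  (fun x y z => esym (Rplus_assoc x y z)) Rplus_comm Rplus_0_l.

Lemma Rsum_mulr (I : Type) (r : seq I) (P : pred I) (F : I -> R) (c : R) :
  (c * \big[Rplus/0]_(i <- r | P i) F i = \big[Rplus/0]_(i <- r | P i) (c * F i))%R.
Proof. exact: (big_morph _ (Rmult_plus_distr_l c) (Rmult_0_r c)). Qed.

Lemma Csum_mulr (I : Type) (r : seq I) (P : pred I) (F : I -> C) (c : C) :
  c * \big[Cplus/RtoC 0]_(i <- r | P i) F i =
  \big[Cplus/RtoC 0]_(i <- r | P i) (c * F i).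
Proof. exact: (big_morph _ (Cmult_plus_distr_l c) (Cmult_0_r c)). Qed.

Lemma RtoC_sum (I : Type) (r : seq I) (P : pred I) (F : I -> R) :
  RtoC (\big[Rplus/0%R]_(i <- r | P i) F i) =
  \big[Cplus/RtoC 0]_(i <- r | P i) RtoC (F i).
Proof. exact: (big_morph _ RtoC_plus (erefl _)). Qed.

Lemma Rsum_le (m n : nat) (F G : nat -> R) :
  (forall i, (m <= i)%N -> (i < n)%N -> (F i <= G i)%R) ->
  (\big[Rplus/0]_(m <= i < n) F i <= \big[Rplus/0]_(m <= i < n) G i)%R.
Proof.
move=> FG; rewrite big_nat_cond [X in (_ <= X)%R]big_nat_cond.
apply: (big_ind2 (fun x y => (x <= y)%R)) => [|*|i]; [lra|lra|].
by move=> /andP[/andP[mi im] _]; apply: FG.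
Qed.

Lemma Rsum_ge0 (I : Type) (r : seq I) (P : pred I) (F : I -> R) :
  (forall i, P i -> (0 <= F i)%R) -> (0 <= \big[Rplus/0]_(i <- r | P i) F i)%R.
Proof. by move=> F0; apply: big_ind => [|*|//]; lra. Qed.

Lemma Cmod_sum (I : Type) (r : seq I) (P : pred I) (F : I -> C) :
  (Cmod (\big[Cplus/RtoC 0]_(i <- r | P i) F i) <=
   \big[Rplus/0]_(i <- r | P i) Cmod (F i))%R.
Proof.
apply: (big_ind2 (fun x y => (Cmod x <= y)%R)) => [|x1 x2 y1 y2 h1 h2|*].
- by rewrite Cmod_0; lra.
- by apply: Rle_trans (Cmod_triangle _ _) _; lra.
- lra.
Qed.

Lemma Rsum_uniq_le (n : nat) (T : seq nat) (B : nat -> R) :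
  (forall i, (0 <= B i)%R) -> uniq T -> {subset T <= index_iota 1 n} ->
  (\big[Rplus/0]_(i <- T) B i <= \big[Rplus/0]_(1 <= i < n) B i)%R.
Proof.
move=> B0 uT sT.
have pT : perm_eq T [seq i <- index_iota 1 n | i \in T].
  apply: uniq_perm => //; first by rewrite filter_uniq // iota_uniq.
  by move=> i; rewrite mem_filter; case: (boolP (i \in T)) => // /sT ->.
rewrite (perm_big _ pT) /= big_filter big_mkcond; apply: Rsum_le => i _ _.
by case: ifP => _; [lra|exact: B0].
Qed.

Lemma geometric_sum_le (r : R) (n : nat) : (0 <= r < 1)%R ->
  (\big[Rplus/0]_(1 <= i < n.+1) r ^ i <= / (1 - r))%R.
Proof.
move=> r01; apply: (Rmult_le_reg_r (1 - r)); first lra.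
rewrite Rinv_l; last lra.
have -> : ((\big[Rplus/0]_(1 <= i < n.+1) r ^ i) * (1 - r) = r - r ^ n.+1)%R.
  elim: n => [|n IH]; first by rewrite big_geq //=; ring.
  by rewrite big_nat_recr //= Rmult_plus_distr_r IH /=; ring.
have : (0 <= r ^ n.+1)%R by apply: pow_le; lra.
lra.
Qed.

Lemma sum_n_Rsum (f : nat -> R) (n : nat) :
  sum_n (fun i => f i.+1) n = \big[Rplus/0%R]_(1 <= i < n.+2) f i.
Proof.
elim: n => [|n IH]; first by rewrite sum_O big_nat1.
by rewrite sum_Sn IH [RHS]big_nat_recr.
Qed.

Lemma sum_n_Csum (f : nat -> C) (n : nat) :
  sum_n (G := C_AbelianMonoid) (fun i => f i.+1) n =
  \big[Cplus/RtoC 0]_(1 <= i < n.+2) f i.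
Proof.
elim: n => [|n IH]; first by rewrite sum_O big_nat1.
by rewrite sum_Sn IH [RHS]big_nat_recr.
Qed.

Lemma filterlim_Cmod (u : nat -> C) (l : C) :
  (forall e : R, (0 < e)%R -> exists N0 : nat, forall N, (N0 <= N)%N ->
    (Cmod (u N - l) < e)%R) ->
  filterlim u eventually (locally l).
Proof.
move=> ul Q /(@locally_norm_le_locally _ C_NormedModule) [eps HQ].
have [N0 HN] := ul eps (cond_pos eps); exists N0 => N /leP le.
exact/HQ/HN.
Qed.

Lemma Cmod_filterlim (u : nat -> C) (l : C) (e : R) :
  filterlim u eventually (locally l) -> (0 < e)%R ->
  exists N0 : nat, forall N, (N0 <= N)%N -> (Cmod (u N - l) < e)%R.
Proof.
move=> ul e0.
have /ul [N0 HN] : locally l (fun x => Cmod (x - l) < e)%R.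
  apply: (@locally_le_locally_norm _ C_NormedModule).
  by exists (mkposreal e e0).
by exists N0 => N /leP; exact: HN.
Qed.

(* With A_N the N-th partial sum of a, the second sum is
   sum_(d <= N) a_d A_(N/d) L_d, so it differs from Z times the first one by at
   most K sum_(d <= N) a_d (Z - A_(N/d)) <= K (Z^2 - A_M^2) whenever M^2 <= N. *)
Lemma dirichlet_sum_cvg (a : nat -> R) (L l : nat -> C) (Z K : R) :
  (forall i, (0 < i)%N -> (0 <= a i)%R) ->
  (forall d m, (0 < d)%N -> (0 < m)%N -> a (d * m)%N = (a d * a m)%R) ->
  is_series (fun n => a n.+1) Z ->
  (forall d, (0 < d)%N -> (Cmod (L d) <= K)%R) ->
  (forall i N, (0 < i)%N -> (i <= N)%N ->
    l i = \big[Cplus/RtoC 0]_(1 <= d < N.+1 | (d %| i)%N) L d) ->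
  exists T : C,
    filterlim (fun N : nat => \big[Cplus/RtoC 0]_(1 <= d < N.+1) (a d * L d))
      eventually (locally T) /\
    filterlim (fun N : nat => \big[Cplus/RtoC 0]_(1 <= i < N.+1) (a i * l i))
      eventually (locally (Z * T)).
Proof.
move=> a0 aM aZ LK lL.
have K0 : (0 <= K)%R by apply: Rle_trans (LK 1%N isT); exact: Cmod_ge_0.
pose H (N : nat) := \big[Rplus/0%R]_(1 <= i < N.+1) a i.
have Hincr m n : (m <= n)%N -> (H m <= H n)%R.
  move=> mn; rewrite /H [X in (_ <= X)%R](@big_cat_nat _ _ _ m.+1) //=.
  suff : (0 <= \big[Rplus/0]_(m.+1 <= i < n.+1) a i)%R by lra.
  rewrite big_nat_cond; apply: Rsum_ge0 => i /andP[/andP[mi _] _].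
  by apply: a0; apply: leq_ltn_trans mi.
have Hlim : is_lim_seq H Z.
  apply/is_lim_seq_incr_1.
  by apply: (is_lim_seq_ext (sum_n (fun n => a n.+1))) => // n; exact: sum_n_Rsum.
have HZ N : (H N <= Z)%R.
  by apply: (is_lim_seq_incr_compare H) => // n; apply: Hincr.
have H0 N : (0 <= H N)%R.
  by have := Hincr 0%N N isT; rewrite {1}/H big_geq.
have Z0 : (0 <= Z)%R by apply: Rle_trans (HZ 0%N).
have [T HT] : ex_series (V := C_NormedModule) (fun n => RtoC (a n.+1) * L n.+1).
  apply: (@ex_series_le _ C_CompleteNormedModule _ (fun n => K * a n.+1)%R) => [n|].
    rewrite -[norm _]/(Cmod _) Cmod_mult Cmod_R Rabs_pos_eq; last exact: a0.
    rewrite Rmult_comm; apply: Rmult_le_compat_r; [exact: a0|exact: LK].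
  by exists (scal K Z); apply: is_series_scal_l.
pose TN (N : nat) := \big[Cplus/RtoC 0]_(1 <= d < N.+1) (a d * L d).
pose SN (N : nat) := \big[Cplus/RtoC 0]_(1 <= i < N.+1) (a i * l i).
have TT : filterlim TN eventually (locally T).
  apply: filterlim_Cmod => e e0; have [N0 HN] := Cmod_filterlim HT e0.
  exists N0.+1 => -[//|N] /HN; rewrite /TN -sum_n_Csum.
  by [].
have SE N : SN N = \big[Cplus/RtoC 0]_(1 <= d < N.+1) (a d * H (N %/ d)%N * L d).
  transitivity (\big[Cplus/RtoC 0]_(1 <= i < N.+1)
      \big[Cplus/RtoC 0]_(1 <= d < N.+1 | (d %| i)%N) (a i * L d)).
    apply: eq_big_nat => i /andP[i0 iN].
    by rewrite (lL i N) // Csum_mulr.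
  rewrite (exchange_big_dep xpredT) //=; apply: eq_big_nat => d /andP[d0 dN].
  transitivity (\big[Cplus/RtoC 0]_(1 <= m < (N %/ d).+1) (a (d * m)%N * L d)).
    rewrite -[RHS](@sum_multiples C xpredT (fun i => a i * L d) d N d0).
    by apply: eq_bigl => i; rewrite andbT.
  rewrite /H RtoC_sum [X in _ = X]Cmult_comm Cmult_assoc Csum_mulr.
  apply: eq_big_nat => m /andP[m0 _]; rewrite aM // RtoC_mult.
  ring.
have diff M N : (M * M <= N)%N ->
    (Cmod (SN N - Z * TN N) <= K * (Z * Z - H M * H M))%R.
  move=> MN.
  have -> : SN N - Z * TN N =
      \big[Cplus/RtoC 0]_(1 <= d < N.+1) (RtoC (- (a d * (Z - H (N %/ d)%N))) * L d).
    rewrite /Cminus SE /TN.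
    have -> (x : C) : - (Z * x) = (- RtoC Z) * x by ring.
    rewrite Csum_mulr -big_split /=; apply: eq_bigr => d _.
    by rewrite RtoC_opp RtoC_mult RtoC_minus; ring.
  apply: Rle_trans (Cmod_sum _ _ _) _.
  apply: (@Rle_trans _ (\big[Rplus/0%R]_(1 <= d < N.+1)
      (K * (Z * a d + - (a d * H (N %/ d)%N)))%R)).
    apply: Rsum_le => d d0 _.
    have ad := a0 d d0; have hd := HZ (N %/ d)%N.
    rewrite Cmod_mult Cmod_R Rabs_Ropp Rabs_pos_eq; last by nra.
    rewrite Rmult_comm.
    have -> : (Z * a d + - (a d * H (N %/ d)%N) = a d * (Z - H (N %/ d)%N))%R by ring.
    by apply: Rmult_le_compat_r; [nra|exact: LK].
  rewrite -Rsum_mulr big_split /= -Rsum_mulr; apply: Rmult_le_compat_l => //.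
  have E1 : (Z * H N <= Z * Z)%R by apply: Rmult_le_compat_l.
  suff E2 : (H M * H M <= \big[Rplus/0%R]_(1 <= d < N.+1) (a d * H (N %/ d)%N)%R)%R.
    have <- : (-1 * \big[Rplus/0%R]_(1 <= d < N.+1) (a d * H (N %/ d)%N)%R =
      \big[Rplus/0%R]_(1 <= d < N.+1) (- (a d * H (N %/ d)%N))%R)%R.
      by rewrite Rsum_mulr; apply: eq_bigr => d _; ring.
    rewrite -/(H N); lra.
  have MN' : (M <= N)%N.
    by apply: leq_trans MN; case: (M) => // m; rewrite leq_pmulr.
  rewrite (@big_cat_nat _ _ _ M.+1) //=.
  have P2 : (0 <= \big[Rplus/0%R]_(M.+1 <= d < N.+1) (a d * H (N %/ d)%N)%R)%R.
    rewrite big_nat_cond; apply: Rsum_ge0 => i /andP[/andP[mi _] _].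
    by apply: Rmult_le_pos => //; apply: a0; apply: leq_ltn_trans mi.
  suff : (H M * H M <= \big[Rplus/0%R]_(1 <= d < M.+1) (a d * H (N %/ d)%N)%R)%R by lra.
  rewrite {2}/H Rsum_mulr; apply: Rsum_le => d d0 dM.
  rewrite Rmult_comm; apply: Rmult_le_compat_l; first exact: a0.
  apply: Hincr; rewrite leq_divRL //; apply: leq_trans MN.
  by rewrite leq_mul2l -ltnS dM orbT.
exists T; split => //; apply: filterlim_Cmod => e e0.
have e1 : (0 < e / 2 / (Z + 1))%R by apply: Rdiv_lt_0_compat; lra.
have [N1 HN1] := Cmod_filterlim TT e1.
have [M HM] : exists M : nat, (K * (Z * Z - H M * H M) < e / 2)%R.
  have d0 : (0 < e / 2 / (K * (2 * Z) + 1))%R.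
    by apply: Rdiv_lt_0_compat; nra.
  have /is_lim_seq_spec /(_ (mkposreal _ d0)) [M /(_ M (Nat.le_refl M)) /=] := Hlim.
  have hm := HZ M; have h0 := H0 M.
  rewrite Rabs_left1; last lra; move=> hM; exists M.
  have {}hM : ((Z - H M) * (K * (2 * Z) + 1) < e / 2)%R.
    replace (e / 2)%R with (e / 2 / (K * (2 * Z) + 1) * (K * (2 * Z) + 1))%R
      by (field; nra).
    by apply: Rmult_lt_compat_r; [nra|lra].
  have : (K * (Z * Z - H M * H M) <= (Z - H M) * (K * (2 * Z)))%R.
    have -> : (Z * Z - H M * H M = (Z - H M) * (Z + H M))%R by ring.
    have : (0 <= K * (Z - H M))%R by apply: Rmult_le_pos; lra.
    nra.
  nra.
exists (maxn N1 (M * M)) => N; rewrite geq_max => /andP[/HN1 h1 /diff h2].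
have -> : SN N - Z * T = (SN N - Z * TN N) + Z * (TN N - T) by ring.
apply: Rle_lt_trans (Cmod_triangle _ _) _.
rewrite Cmod_mult Cmod_R Rabs_pos_eq //.
have : (Cmod (TN N - T) * (Z + 1) < e / 2)%R.
  replace (e / 2)%R with (e / 2 / (Z + 1) * (Z + 1))%R by (field; lra).
  by apply: Rmult_lt_compat_r; lra.
have := Cmod_ge_0 (TN N - T); nra.
Qed.

Lemma Rpower_telescope (s x : R) : (1 < s)%R -> (0 < x)%R ->
  ((s - 1) * / Rpower (x + 1) s + Rpower (x + 1) (1 - s) <= Rpower x (1 - s))%R.
Proof.
move=> s1 x0; set y := (x + 1)%R.
have E1 : (/ Rpower y s = Rpower y (1 - s) * / y)%R.
  rewrite -Rpower_Ropp -{3}(Rpower_1 y) -?Rpower_Ropp; last by rewrite /y; lra.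
  by rewrite -Rpower_plus; congr Rpower; ring.
have E2 : (Rpower x (1 - s) = Rpower y (1 - s) * exp ((s - 1) * (ln y - ln x)))%R.
  by rewrite /Rpower -exp_plus; congr exp; ring.
have L : (/ y <= ln y - ln x)%R.
  rewrite -ln_div; try (rewrite /y; lra).
  have := @ln_ge (y / x) ltac:(by apply: Rdiv_lt_0_compat; rewrite /y; lra).
  have -> : (1 - / (y / x) = / y)%R by rewrite /y; field; lra.
  by [].
have P0 : (0 < Rpower y (1 - s))%R by apply: exp_pos.
have := exp_ineq1_le ((s - 1) * (ln y - ln x)); rewrite E1 E2 => E3.
have : ((s - 1) * / y <= (s - 1) * (ln y - ln x))%R by apply: Rmult_le_compat_l; lra.
by move=> E4; nra.
Qed.

Lemma is_series_zeta (s : R) : (1 < s)%R ->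
  is_series (fun n : nat => / Rpower (INR n.+1) s)%R (zeta s).
Proof.
move=> s1; apply: Series_correct.
have B n : (sum_n (fun n : nat => / Rpower (INR n.+1) s)%R n +
    Rpower (INR n.+1) (1 - s) / (s - 1) <= 1 + / (s - 1))%R.
  elim: n => [|n IH].
    rewrite sum_O /Rpower ln_1 !Rmult_0_r exp_0; lra.
  rewrite sum_Sn -[plus _ _]/(_ + _)%R.
  have n0 : (0 < INR n.+1)%R by apply: lt_0_INR; apply/ltP.
  have := Rpower_telescope s1 n0; rewrite -S_INR => T.
  suff : (/ Rpower (INR n.+2) s + Rpower (INR n.+2) (1 - s) / (s - 1) <=
    Rpower (INR n.+1) (1 - s) / (s - 1))%R by lra.
  apply: (Rmult_le_reg_l (s - 1)); first lra.
  replace ((s - 1) * (Rpower (INR n.+1) (1 - s) / (s - 1)))%R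
    with (Rpower (INR n.+1) (1 - s)) by (field; lra).
  apply: Rle_trans T; right; field; split; last lra.
  by apply: Rgt_not_eq; apply: exp_pos.
have [l Hl] : ex_finite_lim_seq (sum_n (fun n : nat => / Rpower (INR n.+1) s)%R).
  apply: (ex_finite_lim_seq_incr _ (1 + / (s - 1))%R) => n.
    rewrite sum_Sn -[plus _ _]/(_ + _)%R.
    have : (0 < / Rpower (INR n.+2) s)%R by apply: Rinv_0_lt_compat; apply: exp_pos.
    lra.
  apply: Rle_trans (B n).
  have : (0 < Rpower (INR n.+1) (1 - s) / (s - 1))%R.
    by apply: Rdiv_lt_0_compat; [apply: exp_pos|lra].
  lra.
by exists l.
Qed.

Lemma Cmod_sum_coprime_le (f : nat -> nat -> C) (B : nat -> R) (n : nat) :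
  (forall g k m, (0 < g)%N -> f (g * k)%N (g * m)%N = f k m) ->
  (0 < n)%N -> (forall m, (0 <= B m)%R) ->
  (forall m, (0 < m)%N ->
    (Cmod (\big[Cplus/RtoC 0]_(1 <= k < m.+1) f k m) <= B m)%R) ->
  (Cmod (\big[Cplus/RtoC 0]_(1 <= k < n.+1 | coprime k n) f k n) <=
    \big[Rplus/0%R]_(1 <= m < n.+1) B m)%R.
Proof.
move=> fM n0 B0 fB; have [P [M [u sub E]]] := sum_coprime_signed fM n0.
apply: Rle_trans (Rsum_uniq_le B0 u sub).
have -> : \big[Cplus/RtoC 0]_(1 <= k < n.+1 | coprime k n) f k n =
  \big[Cplus/RtoC 0]_(m <- P) \big[Cplus/RtoC 0]_(1 <= k < m.+1) f k m -
  \big[Cplus/RtoC 0]_(m <- M) \big[Cplus/RtoC 0]_(1 <= k < m.+1) f k m by exact: E.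
have aux T : {subset T <= P ++ M} ->
    (Cmod (\big[Cplus/RtoC 0]_(m <- T) \big[Cplus/RtoC 0]_(1 <= k < m.+1) f k m)
      <= \big[Rplus/0%R]_(m <- T) B m)%R.
  move=> sT; apply: Rle_trans (Cmod_sum _ _ _) _.
  rewrite big_seq [X in (_ <= X)%R]big_seq.
  apply: (big_ind2 (fun x y => (x <= y)%R)) => [|*|m /sT /sub]; [lra|lra|].
  by rewrite mem_index_iota => /andP[m0 _]; apply: fB.
rewrite big_cat /=; apply: Rle_trans (Cmod_triangle _ _) _; rewrite Cmod_opp.
by apply: Rplus_le_compat; apply: aux => m mT; rewrite mem_cat mT ?orbT.
Qed.

Lemma continuous_Cexp (w : C) : filterlim Cexp (locally w) (locally (Cexp w)).
Proof.
have cexp : continuous (fun w : C => exp (Re w)) w.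
  by apply: (continuous_comp Re exp); [exact: continuous_fst|exact: continuous_exp].
have c1 : continuous (fun w : C => exp (Re w) * cos (Im w))%R w.
  apply: (continuous_mult (K := R_AbsRing)) => //.
  by apply: (continuous_comp Im cos); [exact: continuous_snd|exact: continuous_cos].
have c2 : continuous (fun w : C => exp (Re w) * sin (Im w))%R w.
  apply: (continuous_mult (K := R_AbsRing)) => //.
  by apply: (continuous_comp Im sin); [exact: continuous_snd|exact: continuous_sin].
move=> Q [eps HQ].
have [d1 h1] := c1 _ (locally_ball _ eps).
have [d2 h2] := c2 _ (locally_ball _ eps).
exists (mkposreal _ (Rmin_stable_in_posreal d1 d2)) => x wx; apply: HQ; split.
  by apply: h1; apply: ball_le wx; apply: Rmin_l.
by apply: h2; apply: ball_le wx; apply: Rmin_r.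
Qed.

Lemma is_inf_prod_Cexp (a u : nat -> C) (T : C) :
  (forall i, (0 < i)%N -> a i = Cexp (u i)) ->
  filterlim (fun N : nat => \big[Cplus/RtoC 0]_(1 <= i < N.+1) u i)
    eventually (locally T) ->
  is_inf_prod a (Cexp T).
Proof.
move=> au uT; have := filterlim_comp _ _ _ _ _ _ _ _ uT (@continuous_Cexp T).
apply: filterlim_ext => N.
by rewrite Cexp_Csum; apply: eq_big_nat => i /andP[i0 _]; rewrite au.
Qed.

Lemma filterlim_Cmult (u : nat -> C) (c l : C) :
  filterlim u eventually (locally l) ->
  filterlim (fun n => c * u n) eventually (locally (c * l)).
Proof.
move=> ul; apply: filterlim_comp ul _.
exact: (@filterlim_scal_r C_AbsRing C_NormedModule c l).
Qed.

Theorem theorem2p2 (s : R) (hs : 1 < s) (z : C) (hz : Cmod z < 1) :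
  exists P : C,
    is_inf_prod
      (fun i : nat =>
         Cexp (RtoC (- (1 / Rpower (INR i) s))%R * Clog (1 - z ^ i))) P /\
    is_inf_prod
      (fun i : nat =>
         Cexp (RtoC (- (zeta s / Rpower (INR i) s))%R *
               disc_log (cyclo_hat i) z)) P.
Proof.
pose f (k n : nat) := Clog (1 - z * root_frac k n).
have fM g k m : (0 < g)%N -> f (g * k)%N (g * m)%N = f k m.
  by move=> g0; rewrite /f root_frac_scale.
pose l (n : nat) := Clog (1 - z ^ n).
pose L (n : nat) := \big[Cplus/RtoC 0]_(1 <= k < n.+1 | coprime k n) f k n.
pose a (n : nat) := (/ Rpower (INR n) s)%R.
have r0 := Cmod_ge_0 z; set r := Cmod z in r0 hz.
pose B (m : nat) := (2 / (1 - r) * r ^ m)%R.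
have q0 : (0 < 2 / (1 - r))%R by apply: Rdiv_lt_0_compat; lra.
have B0 m : (0 <= B m)%R by apply: Rmult_le_pos; [lra|apply: pow_le].
have fB m : (0 < m)%N -> (Cmod (\big[Cplus/RtoC 0]_(1 <= k < m.+1) f k m) <= B m)%R.
  move=> m0; rewrite /f -Clog_one_sub_pow //.
  have zm1 := Cmod_pow_lt1 m0 hz.
  apply: Rle_trans (Clog_one_sub_bound zm1) _; rewrite Cmod_pow -/r /B.
  have rm0 : (0 <= r ^ m)%R by apply: pow_le.
  have rm : (r ^ m <= r)%R.
    case: (m) m0 => // k _ /=.
    by have := pow_incr r 1 k ltac:(lra); rewrite pow1; nra.
  have : (/ (1 - r ^ m) <= / (1 - r))%R by apply: Rinv_le_contravar; lra.
  by rewrite /Rdiv; nra.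
have LK d : (0 < d)%N -> (Cmod (L d) <= 2 / (1 - r) * / (1 - r))%R.
  move=> d0; apply: Rle_trans (Cmod_sum_coprime_le fM d0 B0 fB) _.
  rewrite /B -Rsum_mulr; apply: Rmult_le_compat_l; first lra.
  by apply: geometric_sum_le; lra.
have lL i N : (0 < i)%N -> (i <= N)%N ->
    l i = \big[Cplus/RtoC 0]_(1 <= d < N.+1 | (d %| i)%N) L d.
  by move=> i0 iN; rewrite /l Clog_one_sub_pow //; exact: (sum_coprime_divisors fM i0 iN).
have a0 i : (0 < i)%N -> (0 <= a i)%R.
  by move=> _; apply: Rlt_le; apply: Rinv_0_lt_compat; apply: exp_pos.
have aM d m : (0 < d)%N -> (0 < m)%N -> a (d * m)%N = (a d * a m)%R.
  move=> d0 m0; rewrite /a mult_INR -Rinv_mult Rpower_mult_distr //.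
    by apply: lt_0_INR; apply/ltP.
  by apply: lt_0_INR; apply/ltP.
have [T [LT lT]] := dirichlet_sum_cvg a0 aM (is_series_zeta hs) LK lL.
exists (Cexp (RtoC (-1) * (zeta s * T))); split.
  apply: (is_inf_prod_Cexp (u := fun i => RtoC (-1) * (a i * l i))) => [i i0|].
    congr Cexp; rewrite Cmult_assoc -RtoC_mult; congr (RtoC _ * _).
    by rewrite /a /Rdiv; ring.
  by apply: filterlim_ext (filterlim_Cmult (c := RtoC (-1)) lT) => N; exact: Csum_mulr.
apply: (is_inf_prod_Cexp (u := fun i => RtoC (-1) * zeta s * (a i * L i))) => [i i0|].
  rewrite disc_log_cyclo_hat //; congr Cexp.
  rewrite Cmult_assoc -!RtoC_mult; congr (RtoC _ * _).
  by rewrite /a /Rdiv; ring.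
rewrite Cmult_assoc.
by apply: filterlim_ext (filterlim_Cmult (c := RtoC (-1) * zeta s) LT) => N;
  exact: Csum_mulr.
Qed.
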